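(* Let $\Bbbk$ be either $\mathbb{Z}$ or a prime field and let $n\in\mathbb{N}$. Every functor $F:\mathbf{gr}\to\Bbbk\text{-}\mathbf{Mod}$ that is polynomial of degree at most $n$ has a filtration by subfunctors $$0=F_{-1}\subset F_0\subset F_1\subset\dots\subset F_{n-1}\subset F_n=F$$ such that each subquotient $F_i/F_{i-1}$ (for $0\le i\le n$) is polynomial of degree at most $n-i$ and belongs to the essential image of the functor $\mathbf{Fct}(\mathbf{ab},\Bbbk\text{-}\mathbf{Mod})\to\mathbf{Fct}(\mathbf{gr},\Bbbk\text{-}\mathbf{Mod})$ given by precomposition with the abelianization functor $\mathbf{gr}\to\mathbf{ab}$.
   Context: $\mathbf{gr}$ (resp. $\mathbf{ab}$) is the category of free groups (resp. free abelian groups) of finite rank with all group homomorphisms. $\mathbf{Fct}(\mathcal{C},\mathcal{A})$ is the category of functors from $\mathcal{C}$ to $\mathcal{A}$. A prime field is $\mathbb{Q}$ or $\mathbb{F}_p$. The free product $*$ is the coproduct of $\mathbf{gr}$, whose zero object is the trivial group. A functor $F:\mathbf{gr}\to\Bbbk\text{-}\mathbf{Mod}$ is polynomial of degree at most $m-1$ ($m\ge1$) if its $m$-th cross effect $$cr_m(F)(A_1,\dots,A_m)=\ker\Big(F(A_1*\cdots*A_m)\to\bigoplus_{i=1}^m F(A_1*\cdots*\widehat{A_i}*\cdots*A_m)\Big)$$ (the $i$-th component being induced by the projection killing $A_i$) vanishes identically. *)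

(* Defs.v *)
From HB Require Import structures.
From mathcomp Require Import all_boot all_order all_algebra.
From mathcomp Require Import generic_quotient ring_quotient.
From mathcomp Require Import boolp.

Set Implicit Arguments.
Unset Strict Implicit.
Unset Printing Implicit Defensive.

Import GRing.Theory.
Local Open Scope ring_scope.
Local Open Scope quotient_scope.

Record category := Category {
  obj :> Type;
  hom : obj -> obj -> Type;
  idm : forall X, hom X X;
  comp : forall X Y Z, hom Y Z -> hom X Y -> hom X Z;
  comp1m : forall X Y (f : hom X Y), comp (idm Y) f = f;
  compm1 : forall X Y (f : hom X Y), comp f (idm X) = f;
  compA : forall X Y Z T (f : hom Z T) (g : hom Y Z) (h : hom X Y),
    comp f (comp g h) = comp (comp f g) h
}.

Arguments hom {c} X Y.
Arguments idm {c} X.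
Arguments comp {c X Y Z} _ _.

Record functor (C D : category) := Functor {
  fobj :> C -> D;
  fmap : forall X Y : C, hom X Y -> hom (fobj X) (fobj Y);
  fmap1 : forall X : C, fmap (idm X) = idm (fobj X);
  fmapM : forall (X Y Z : C) (g : hom Y Z) (f : hom X Y),
    fmap (comp g f) = comp (fmap g) (fmap f)
}.

Arguments fmap {C D} F {X Y} f : rename.

Section FunctorComp.
Variables (C D E : category) (G : functor D E) (F : functor C D).

Let gf_map X Y (f : hom X Y) : hom (G (F X)) (G (F Y)) := fmap G (fmap F f).

Fact functor_comp1 X : gf_map (idm X) = idm (G (F X)).
Proof. by rewrite /gf_map !fmap1. Qed.

Fact functor_compM X Y Z (g : hom Y Z) (f : hom X Y) :
  gf_map (comp g f) = comp (gf_map g) (gf_map f).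
Proof. by rewrite /gf_map !fmapM. Qed.

Definition functor_comp : functor C E := Functor functor_comp1 functor_compM.
End FunctorComp.

Definition is_iso (C : category) (X Y : C) (f : hom X Y) : Prop :=
  exists g : hom Y X, comp g f = idm X /\ comp f g = idm Y.

Definition natural (C D : category) (F G : functor C D)
    (eta : forall X : C, hom (F X) (G X)) : Prop :=
  forall (X Y : C) (f : hom X Y),
    comp (eta Y) (fmap F f) = comp (fmap G f) (eta X).

Definition isomorphic_functors (C D : category) (F G : functor C D) : Prop :=
  exists eta : forall X : C, hom (F X) (G X),
    natural eta /\ forall X : C, is_iso (eta X).

(** The essential image of [Fct(D, E) -> Fct(C, E)], [G |-> G o P]. *)
Definition in_precomp_essential_image (C D E : category) (P : functor C D)
    (F : functor C E) : Prop :=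
  exists G : functor D E, isomorphic_functors (functor_comp G P) F.

Section KMod.
Variable k : pzRingType.

Lemma linear_ext (U V : lmodType k) (f g : {linear U -> V}) : f =1 g -> f = g.
Proof.
move=> /funext fg; case: f g fg => f [[nf] [af]] [g [[ng] [ag]]] /= fg.
by subst g; rewrite (Prop_irrelevance nf ng) (Prop_irrelevance af ag).
Qed.

Let kid (U : lmodType k) : {linear U -> U} := idfun.
Let kcomp (U V W : lmodType k) (g : {linear V -> W}) (f : {linear U -> V})
  : {linear U -> W} := g \o f.

Fact kcomp1m (U V : lmodType k) (f : {linear U -> V}) : kcomp (kid V) f = f.
Proof. exact: linear_ext. Qed.

Fact kcompm1 (U V : lmodType k) (f : {linear U -> V}) : kcomp f (kid U) = f.
Proof. exact: linear_ext. Qed.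

Fact kcompA (U V W X : lmodType k) (f : {linear W -> X}) (g : {linear V -> W})
  (h : {linear U -> V}) : kcomp f (kcomp g h) = kcomp (kcomp f g) h.
Proof. exact: linear_ext. Qed.

Definition kMod : category := Category kcomp1m kcompm1 kcompA.
End KMod.



Section SubQuotModules.
Variables (k : pzRingType) (V : lmodType k) (S : submodClosed V).

Definition submodule : Type := {x : V | x \in S}.

HB.instance Definition _ := SubType.on submodule.
HB.instance Definition _ := Choice.on submodule.
HB.instance Definition _ := [SubChoice_isSubLmodule of submodule by <:].

Fact submod_zmod_closed : zmod_closed S.
Proof.
by split=> [|x y xS yS]; rewrite ?rpred0 // -scaleN1r rpredD // rpredZ.
Qed.

Definition submod_zmod : zmodClosed V :=
  HB.pack (GRing.SubmodClosed.sort S)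
    (GRing.isZmodClosed.Build V (GRing.SubmodClosed.sort S) submod_zmod_closed).

Definition quotmod : Type := Quotient.quot submod_zmod.

HB.instance Definition _ := GRing.Zmodule.on quotmod.
HB.instance Definition _ := EqQuotient.on quotmod.

Definition qproj : V -> quotmod := \pi_(Quotient.quot submod_zmod).

Lemma qprojP x y : (qproj x = qproj y) <-> (x - y \in S).
Proof.
rewrite [_ \in _](Quotient.idealrBE submod_zmod).
by split=> [e|/eqP//]; apply/eqP.
Qed.

Lemma qproj_repr (x : quotmod) : qproj (repr x) = x.
Proof. exact: reprK. Qed.

Lemma qprojD : {morph qproj : x y / x + y}.
Proof. exact: Quotient.pi_add. Qed.

Definition qscale (a : k) (x : quotmod) : quotmod := qproj (a *: repr x).

Lemma qscaleE a x : qscale a (qproj x) = qproj (a *: x).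
Proof. by apply/qprojP; rewrite -scalerBr rpredZ //; apply/qprojP/reprK. Qed.

Fact qscaleA a b x : qscale a (qscale b x) = qscale (a * b) x.
Proof. by rewrite -[x]qproj_repr !qscaleE scalerA. Qed.

Fact qscale1 : left_id 1 qscale.
Proof. by move=> x; rewrite -[x]qproj_repr qscaleE scale1r. Qed.

Fact qscaleDr : right_distributive qscale +%R.
Proof.
move=> a x y; rewrite -[x]qproj_repr -[y]qproj_repr -qprojD !qscaleE.
by rewrite scalerDr qprojD.
Qed.

Fact qscaleDl x : {morph qscale^~ x : a b / a + b}.
Proof. by move=> a b; rewrite -[x]qproj_repr !qscaleE scalerDl qprojD. Qed.

HB.instance Definition _ :=
  GRing.Zmodule_isLmodule.Build k quotmod qscaleA qscale1 qscaleDr qscaleDl.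

Fact qproj_semilinear : linear qproj.
Proof. by move=> a x y; rewrite qprojD -qscaleE. Qed.

HB.instance Definition _ :=
  GRing.isLinear.Build k V quotmod *:%R qproj qproj_semilinear.

End SubQuotModules.

Arguments qproj {k V} S _.

Section InducedMaps.
Variables (k : pzRingType) (V W : lmodType k) (f : {linear V -> W}).
Variables (S : submodClosed V) (T : submodClosed W).
Hypothesis fST : forall x, x \in S -> f x \in T.

Definition submap (x : submodule S) : submodule T :=
  Sub (f (val x)) (fST (valP x)).

Fact submap_linear : linear submap.
Proof. by move=> a x y; apply: val_inj; rewrite /= !linearP. Qed.

HB.instance Definition _ :=
  GRing.isLinear.Build k (submodule S) (submodule T) *:%R submap submap_linear.

Let qmap (x : quotmod S) : quotmod T := qproj T (f (repr x)).

Let qmapE x : qmap (qproj S x) = qproj T (f x).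
Proof. by apply/qprojP; rewrite -linearB; apply/fST/qprojP/reprK. Qed.

Fact qmap_linear : linear qmap.
Proof.
move=> a x y; rewrite -[x]qproj_repr -[y]qproj_repr -linearP !qmapE.
by rewrite !linearP.
Qed.

Definition quotmap : {linear quotmod S -> quotmod T} :=
  HB.pack qmap
    (GRing.isLinear.Build k (quotmod S) (quotmod T) *:%R qmap qmap_linear).

Lemma quotmapE x : quotmap (qproj S x) = qproj T (f x).
Proof. exact: qmapE. Qed.

End InducedMaps.

Section Subfunctors.
Variables (k : pzRingType) (C : category).

Definition fmod (F : functor C (kMod k)) (X : C) : lmodType k := F X.

Definition fmor (F : functor C (kMod k)) (X Y : C) (f : hom X Y) :
  {linear fmod F X -> fmod F Y} := fmap F f.

Lemma fmor1 F X : fmor F (idm X) =1 id.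
Proof. by move=> x; rewrite /fmor fmap1. Qed.

Lemma fmorM F X Y Z (g : hom Y Z) (f : hom X Y) :
  fmor F (comp g f) =1 fmor F g \o fmor F f.
Proof. by move=> x; rewrite /fmor fmapM. Qed.

(** [submodClosed] predicates are boolean: classically, these are all the
    submodules. *)
Record subfunctor (F : functor C (kMod k)) := Subfunctor {
  sf_mod :> forall X : C, submodClosed (fmod F X);
  sf_stable : forall (X Y : C) (f : hom X Y) (x : fmod F X),
    x \in sf_mod X -> fmor F f x \in sf_mod Y
}.

Section SubQuotFunctor.
Variables (F : functor C (kMod k)) (S : subfunctor F).

Let sub_obj (X : C) : lmodType k := submodule (S X).
Let sub_map (X Y : C) (f : hom X Y) : {linear sub_obj X -> sub_obj Y} :=
  submap (@sf_stable F S X Y f).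

Fact sub_map1 X : sub_map (idm X) = @idm (kMod k) (sub_obj X).
Proof. by apply: linear_ext => x; apply: val_inj; rewrite /= fmor1. Qed.

Fact sub_mapM X Y Z (g : hom Y Z) (f : hom X Y) :
  sub_map (comp g f) = @comp (kMod k) _ _ _ (sub_map g) (sub_map f).
Proof. by apply: linear_ext => x; apply: val_inj; rewrite /= fmorM. Qed.

Definition subf : functor C (kMod k) :=
  @Functor C (kMod k) sub_obj sub_map sub_map1 sub_mapM.

Let quot_obj (X : C) : lmodType k := quotmod (S X).
Let quot_map (X Y : C) (f : hom X Y) : {linear quot_obj X -> quot_obj Y} :=
  quotmap (@sf_stable F S X Y f).

Fact quot_map1 X : quot_map (idm X) = @idm (kMod k) (quot_obj X).
Proof.
by apply: linear_ext => x; rewrite -[x]qproj_repr /quot_map quotmapE fmor1.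
Qed.

Fact quot_mapM X Y Z (g : hom Y Z) (f : hom X Y) :
  quot_map (comp g f) = @comp (kMod k) _ _ _ (quot_map g) (quot_map f).
Proof.
apply: linear_ext => x; rewrite -[x]qproj_repr /quot_map quotmapE fmorM.
apply: (etrans (y := quot_map g (quot_map f (qproj (S X) (repr x))))) => //.
by rewrite /quot_map (quotmapE (@sf_stable F S X Y f)) quotmapE.
Qed.

Definition quotf : functor C (kMod k) :=
  @Functor C (kMod k) quot_obj quot_map quot_map1 quot_mapM.

End SubQuotFunctor.

Section Subquotient.
Variables (F : functor C (kMod k)) (S T : subfunctor F).

Section At.
Variable X : C.

Definition restr_mem : {pred submodule (S X)} := fun x => val x \in T X.

Fact restr_closed : submod_closed restr_mem.
Proof.
have memE x : (x \in restr_mem) = (val x \in T X) by [].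
split=> [|a x y]; rewrite !memE ?rpred0 // => xT yT.
by rewrite /= rpredD // rpredZ.
Qed.

HB.instance Definition _ :=
  GRing.isSubmodClosed.Build k (submodule (S X)) restr_mem restr_closed.

End At.

Fact restr_stable X Y (f : hom X Y) (x : fmod (subf S) X) :
  x \in restr_mem (X := X) -> fmor (subf S) f x \in restr_mem (X := Y).
Proof. exact: sf_stable. Qed.

(** [T], seen as a subfunctor of [S] (namely, [T] intersected with [S]). *)
Definition restrf : subfunctor (subf S) :=
  @Subfunctor (subf S) (fun X => restr_mem (X := X)) restr_stable.

Definition subquotf : functor C (kMod k) := quotf restrf.

End Subquotient.
End Subfunctors.

Notation group_hom := UMagmaMorphism.type.

Lemma group_hom_ext (G H : groupType) (f g : group_hom G H) : f =1 g -> f = g.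
Proof.
move=> /funext fg; case: f g fg => f [[nf] [af]] [g [[ng] [ag]]] /= fg.
by subst g; rewrite (Prop_irrelevance nf ng) (Prop_irrelevance af ag).
Qed.

Definition group_id (G : groupType) : group_hom G G := idfun.
Definition group_comp (G H K : groupType) (g : group_hom H K)
  (f : group_hom G H) : group_hom G K := g \o f.

Definition free_group_basis (G : groupType) (I : Type) (x : I -> G) : Prop :=
  forall (H : groupType) (y : I -> H),
    exists! f : group_hom G H, forall i, f (x i) = y i.

(** Freeness is the existence, as a property, of a finite basis: objects carry
    no chosen basis. *)
Record gr_obj := GrObj {
  gr_group :> groupType;
  gr_free : exists (I : finType) (x : I -> gr_group), free_group_basis x
}.

Fact group_comp1m (G H : gr_obj) (f : group_hom G H) :
  group_comp (group_id H) f = f.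
Proof. exact: group_hom_ext. Qed.

Fact group_compm1 (G H : gr_obj) (f : group_hom G H) :
  group_comp f (group_id G) = f.
Proof. exact: group_hom_ext. Qed.

Fact group_compA (G H K L : gr_obj) (f : group_hom K L) (g : group_hom H K)
  (h : group_hom G H) :
  group_comp f (group_comp g h) = group_comp (group_comp f g) h.
Proof. exact: group_hom_ext. Qed.

Definition gr : category :=
  @Category gr_obj (fun G H => group_hom G H) (fun G => group_id G)
    (fun G H K g f => group_comp g f) group_comp1m group_compm1 group_compA.

Section FreeProduct.
Local Open Scope group_scope.
Variables (I : finType) (A : I -> groupType).

Definition fp_word : Type := seq {i : I & A i}.
HB.instance Definition _ := Choice.on fp_word.

Definition fp_letter (i : I) (a : A i) : {i : I & A i} := Tagged A a.

(** Two words in the elements of the [A i] are equivalent when they are linked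
    by a chain of insertions and deletions of neutral elements and of
    multiplications and splittings of adjacent letters from the same group. *)
Inductive fp_equiv : fp_word -> fp_word -> Prop :=
| fp_refl w : fp_equiv w w
| fp_sym w1 w2 : fp_equiv w1 w2 -> fp_equiv w2 w1
| fp_trans w1 w2 w3 : fp_equiv w1 w2 -> fp_equiv w2 w3 -> fp_equiv w1 w3
| fp_one u v i : fp_equiv (u ++ [:: fp_letter (1 : A i) & v]) (u ++ v)
| fp_mul u v i (a b : A i) :
    fp_equiv (u ++ [:: fp_letter a, fp_letter b & v])
             (u ++ [:: fp_letter (a * b) & v]).

Definition fp_rel : rel fp_word := fun u v => `[< fp_equiv u v >].

Fact fp_rel_equiv : equiv_class_of fp_rel.
Proof.
split=> [w|u v|u v w]; first exact/asboolP/fp_refl.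
  by apply/asboolP/asboolP; apply: fp_sym.
by move=> /asboolP uv /asboolP vw; apply/asboolP; apply: fp_trans uv vw.
Qed.

Canonical fp_equiv_rel := EquivRelPack fp_rel_equiv.
Canonical fp_encModRel := defaultEncModRel fp_rel.

Definition freeprod : Type := {eq_quot fp_rel}.
HB.instance Definition _ := Choice.on freeprod.
HB.instance Definition _ := EqQuotient.on freeprod.

Definition fp_class (w : fp_word) : freeprod := \pi w.

Lemma fp_classP u v : fp_class u = fp_class v <-> fp_equiv u v.
Proof.
split=> [/eqquotP/asboolP//|uv].
by apply/eqquotP; apply/asboolP.
Qed.

Lemma fp_class_repr x : fp_class (repr x) = x.
Proof. exact: reprK. Qed.

Lemma fp_equiv_repr w : fp_equiv (repr (fp_class w)) w.
Proof. by apply/fp_classP; rewrite fp_class_repr. Qed.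

Definition fp_inv_word (w : fp_word) : fp_word :=
  rev [seq fp_letter (tagged a : A (tag a))^-1 | a : {i & A i} <- w].

Lemma fp_equiv_cat u u' v v' :
  fp_equiv u u' -> fp_equiv v v' -> fp_equiv (u ++ v) (u' ++ v').
Proof.
move=> uu' vv'; apply: (@fp_trans _ (u' ++ v)).
  elim: uu' => {u u'} [w|w1 w2 _|w1 w2 w3 _ h1 _ h2|u1 u2 i|u1 u2 i a b].
  - exact: fp_refl.
  - exact: fp_sym.
  - exact: fp_trans h1 h2.
  - by rewrite -!catA; apply: fp_one.
  - by rewrite -!catA; apply: fp_mul.
elim: vv' => {v v'} [w|w1 w2 _|w1 w2 w3 _ h1 _ h2|u1 u2 i|u1 u2 i a b].
- exact: fp_refl.
- exact: fp_sym.
- exact: fp_trans h1 h2.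
- by rewrite !catA; apply: fp_one.
- by rewrite !catA; apply: fp_mul.
Qed.

Lemma fp_equiv_inv u v :
  fp_equiv u v -> fp_equiv (fp_inv_word u) (fp_inv_word v).
Proof.
rewrite /fp_inv_word.
elim=> {u v} [w|w1 w2 _|w1 w2 w3 _ h1 _ h2|u1 u2 i|u1 u2 i a b].
- exact: fp_refl.
- exact: fp_sym.
- exact: fp_trans h1 h2.
- rewrite !map_cat /= !rev_cat rev_cons -cats1 -catA /= invg1.
  exact: fp_one.
- rewrite !map_cat /= !rev_cat !rev_cons -!cats1 -!catA /= invgM.
  exact: fp_mul.
Qed.

Lemma fp_equiv_mulV w : fp_equiv (w ++ fp_inv_word w) [::].
Proof.
rewrite /fp_inv_word; elim: w => [|[i a] w IHw] /=; first exact: fp_refl.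
rewrite rev_cons -cats1 catA -cat1s.
apply: (@fp_trans _ ([:: fp_letter a] ++ [:: fp_letter a^-1])).
  apply: (fp_equiv_cat (u := [:: fp_letter a]) (fp_refl _)).
  rewrite -[X in fp_equiv _ X]cat0s.
  exact: fp_equiv_cat IHw (fp_refl _).
apply: fp_trans (fp_mul [::] [::] a a^-1) _.
by rewrite mulgV; apply: (fp_one [::] [::]).
Qed.

Lemma fp_inv_wordK w : fp_inv_word (fp_inv_word w) = w.
Proof.
rewrite /fp_inv_word map_rev revK -map_comp -[RHS]map_id.
by apply: eq_map => -[i a] /=; rewrite invgK.
Qed.

Definition fp_mulg (x y : freeprod) : freeprod := fp_class (repr x ++ repr y).
Definition fp_invg (x : freeprod) : freeprod := fp_class (fp_inv_word (repr x)).

Lemma fp_mulE u v : fp_mulg (fp_class u) (fp_class v) = fp_class (u ++ v).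
Proof. by apply/fp_classP/fp_equiv_cat; apply: fp_equiv_repr. Qed.

Lemma fp_invE u : fp_invg (fp_class u) = fp_class (fp_inv_word u).
Proof. exact/fp_classP/fp_equiv_inv/fp_equiv_repr. Qed.

Fact fp_mulA : associative fp_mulg.
Proof.
move=> x y z; rewrite -[x]fp_class_repr -[y]fp_class_repr -[z]fp_class_repr.
by rewrite !fp_mulE catA.
Qed.

Fact fp_mul1 : left_id (fp_class [::]) fp_mulg.
Proof. by move=> x; rewrite -[x]fp_class_repr fp_mulE. Qed.

Fact fp_mulg1 : right_id (fp_class [::]) fp_mulg.
Proof. by move=> x; rewrite -[x]fp_class_repr fp_mulE cats0. Qed.

Fact fp_mulgV : right_inverse (fp_class [::]) fp_invg fp_mulg.
Proof.
move=> x; rewrite -[x]fp_class_repr fp_invE fp_mulE.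
exact/fp_classP/fp_equiv_mulV.
Qed.

Fact fp_mulVg : left_inverse (fp_class [::]) fp_invg fp_mulg.
Proof.
move=> x; rewrite -[x]fp_class_repr fp_invE fp_mulE.
rewrite -[in X in _ ++ X](fp_inv_wordK (repr x)).
exact/fp_classP/fp_equiv_mulV.
Qed.

HB.instance Definition _ :=
  isGroup.Build freeprod fp_mulA fp_mul1 fp_mulg1 fp_mulVg fp_mulgV.

Lemma fp_class_cat u v : fp_class (u ++ v) = fp_class u * fp_class v.
Proof. by rewrite -fp_mulE. Qed.

Definition fp_in (i : I) (a : A i) : freeprod := fp_class [:: fp_letter a].

Fact fp_in_mor i : monoid.monoid_morphism (@fp_in i).
Proof.
split; first exact/fp_classP/(fp_one [::] [::]).
by move=> a b; rewrite -fp_class_cat; apply/esym/fp_classP/(fp_mul [::] [::]).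
Qed.

HB.instance Definition _ i :=
  isUMagmaMorphism.Build (A i) freeprod (@fp_in i) (fp_in_mor i).

Definition fp_inj (i : I) : group_hom (A i) freeprod := @fp_in i.

Section Copairing.
Variables (H : groupType) (f : forall i, group_hom (A i) H).

Definition fp_eval (w : fp_word) : H := \prod_(a <- w) f (tag a) (tagged a).

Lemma fp_eval_equiv u v : fp_equiv u v -> fp_eval u = fp_eval v.
Proof.
rewrite /fp_eval; elim=> {u v} [//|//|w1 w2 w3 _ -> _ ->//|u v i|u v i a b].
  by rewrite !big_cat big_cons /= gmulf1 mul1g.
by rewrite !big_cat !big_cons /= gmulfM !mulgA.
Qed.

Let copair (x : freeprod) : H := fp_eval (repr x).

Let copairE w : copair (fp_class w) = fp_eval w.
Proof. exact/fp_eval_equiv/fp_equiv_repr. Qed.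

Fact fp_copair_mor : monoid.monoid_morphism copair.
Proof.
split=> [|x y]; first by rewrite [1]/(fp_class [::]) copairE /fp_eval big_nil.
rewrite -[x]fp_class_repr -[y]fp_class_repr -fp_class_cat !copairE.
by rewrite /fp_eval big_cat.
Qed.

Definition fp_copair : group_hom freeprod H :=
  HB.pack copair (isUMagmaMorphism.Build freeprod H copair fp_copair_mor).

Lemma fp_copair_inj i a : fp_copair (fp_inj i a) = f i a.
Proof.
rewrite [LHS](copairE [:: fp_letter a]) /fp_eval.
by rewrite big_cons big_nil mulg1.
Qed.

Lemma fp_copair_uniq (g : group_hom freeprod H) :
  (forall i a, g (fp_inj i a) = f i a) -> g = fp_copair.
Proof.
move=> gf; apply: group_hom_ext => x; rewrite -[x]fp_class_repr.
rewrite [RHS]copairE; elim: (repr x) => [|[i a] w IHw].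
  by rewrite /fp_eval big_nil; apply: gmulf1.
by rewrite -cat1s fp_class_cat gmulfM IHw /fp_eval big_cat big_seq1 -gf.
Qed.

End Copairing.
End FreeProduct.

Lemma freeprod_free (I : finType) (A : I -> gr_obj) :
  exists (J : finType) (x : J -> freeprod A), free_group_basis x.
Proof.
pose J i : finType := projT1 (cid (gr_free (A i))).
have xP i : exists x : J i -> A i, free_group_basis x.
  exact: projT2 (cid (gr_free (A i))).
pose x i := projT1 (cid (xP i)); have xfree i : free_group_basis (x i).
  exact: projT2 (cid (xP i)).
exists {i : I & J i}, (fun j => fp_inj A (tag j) (x (tag j) (tagged j))).
move=> H y; pose yy i (j : J i) : H := y (Tagged J j).
pose f i := projT1 (cid (xfree i H (yy i))).
have fP i : unique (fun g : group_hom (A i) H => forall j, g (x i j) = yy i j)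
                   (f i).
  exact: projT2 (cid (xfree i H (yy i))).
exists (fp_copair f); split=> [[i j]|g gy].
  by rewrite fp_copair_inj (fP i).1.
apply/esym/fp_copair_uniq => i a.
rewrite ((fP i).2 (group_comp g (fp_inj A i))) // => j.
exact: (gy (Tagged J j)).
Qed.

Definition gr_freeprod (I : finType) (A : I -> gr) : gr :=
  GrObj (freeprod_free A).

(** The projection killing the factor [A i]. *)
Definition fp_kill (I : finType) (A : I -> gr) (i : I) :
    hom (gr_freeprod A) (gr_freeprod (fun j : {j : I | j != i} => A (val j))) :=
  let A' (j : {j : I | j != i}) : gr_obj := A (val j) in
  fp_copair (A := A) (H := freeprod A') (fun j : I =>
    match boolP (j != i) with
    | AltTrue ji => fp_inj A' (exist _ j ji)
    | AltFalse _ => @one_fun (A j) (freeprod A')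
    end).

Lemma fp_kill_inj (I : finType) (A : I -> gr) (i j : I) (ji : j != i)
    (a : gr_group (A j)) :
  (fp_kill A i : group_hom (freeprod A) _) (fp_inj A j a) =
  fp_inj (fun j : {j : I | j != i} => gr_group (A (val j))) (exist _ j ji) a.
Proof.
rewrite [LHS]fp_copair_inj; case: {-}_ / boolP => [ji'|]; last by rewrite ji.
by rewrite (bool_irrelevance ji' ji).
Qed.

Lemma fp_kill_inj1 (I : finType) (A : I -> gr) (i : I) (a : gr_group (A i)) :
  (fp_kill A i : group_hom (freeprod A) _) (fp_inj A i a) = 1%g.
Proof.
rewrite [LHS]fp_copair_inj; case: {-}_ / boolP => // ii.
by exfalso; move: ii; rewrite eqxx.
Qed.

Section CrossEffects.
Variables (k : pzRingType) (F : functor gr (kMod k)).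

(** The kernel of a map into a direct sum, written componentwise. *)
Definition cross_effect (I : finType) (A : I -> gr)
    (x : fmod F (gr_freeprod A)) : Prop :=
  forall i : I, fmor F (fp_kill A i) x = 0.

(** Degree at most [d], i.e. vanishing of the cross effect of order [d.+1]. *)
Definition polynomial_functor (d : nat) : Prop :=
  forall (A : 'I_d.+1 -> gr) (x : fmod F (gr_freeprod A)),
    cross_effect x -> x = 0.

End CrossEffects.

Lemma additive_ext (A B : zmodType) (f g : {additive A -> B}) :
  f =1 g -> f = g.
Proof.
move=> /funext fg; case: f g fg => f [[nf]] [g [[ng]]] /= fg.
by subst g; rewrite (Prop_irrelevance nf ng).
Qed.

Definition add_id (A : zmodType) : {additive A -> A} := idfun.
Definition add_comp (A B C : zmodType) (g : {additive B -> C})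
  (f : {additive A -> B}) : {additive A -> C} := g \o f.

Definition free_abelian_basis (A : zmodType) (I : Type) (x : I -> A) : Prop :=
  forall (B : zmodType) (y : I -> B),
    exists! f : {additive A -> B}, forall i, f (x i) = y i.

Record ab_obj := AbObj {
  ab_group :> zmodType;
  ab_free : exists (I : finType) (x : I -> ab_group), free_abelian_basis x
}.

Fact add_comp1m (A B : ab_obj) (f : {additive A -> B}) :
  add_comp (add_id B) f = f.
Proof. exact: additive_ext. Qed.

Fact add_compm1 (A B : ab_obj) (f : {additive A -> B}) :
  add_comp f (add_id A) = f.
Proof. exact: additive_ext. Qed.

Fact add_compA (A B C D : ab_obj) (f : {additive C -> D})
  (g : {additive B -> C}) (h : {additive A -> B}) :
  add_comp f (add_comp g h) = add_comp (add_comp f g) h.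
Proof. exact: additive_ext. Qed.

Definition ab : category :=
  @Category ab_obj (fun A B => {additive A -> B}) (fun A => add_id A)
    (fun A B C g f => add_comp g f) add_comp1m add_compm1 add_compA.

Section Abelianization.
Local Open Scope group_scope.
Variable G : groupType.

Inductive derived : G -> Prop :=
| derived_comm x y : derived [~ x, y]
| derived_mul x y : derived x -> derived y -> derived (x * y)
| derived_inv x : derived x -> derived x^-1.

Lemma derived1 : derived 1.
Proof.
rewrite -(mulgV [~ 1, 1 : G]).
by apply: derived_mul; [|apply: derived_inv]; apply: derived_comm.
Qed.

Lemma derivedJ x y : derived x -> derived (x ^ y).
Proof.
move=> dx; have -> : x ^ y = x * [~ x, y] by rewrite commgEl mulgA mulgV mul1g.
by apply: derived_mul => //; apply: derived_comm.
Qed.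

Definition ab_rel : rel G := fun x y => `[< derived (x^-1 * y) >].

Fact ab_rel_equiv : equiv_class_of ab_rel.
Proof.
split=> [x|x y|y x z].
- by apply/asboolP; rewrite mulVg; apply: derived1.
- by apply/asboolP/asboolP => /derived_inv; rewrite invgM invgK.
- move=> /asboolP xy /asboolP yz; apply/asboolP.
  by rewrite -[z](mulVKg y) mulgA; apply: derived_mul.
Qed.

Canonical ab_equiv_rel := EquivRelPack ab_rel_equiv.
Canonical ab_encModRel := defaultEncModRel ab_rel.

(** The quotient [G / [G, G]], written additively. *)
Definition abelianization : Type := {eq_quot ab_rel}.
HB.instance Definition _ := Choice.on abelianization.
HB.instance Definition _ := EqQuotient.on abelianization.

Definition ab_class (x : G) : abelianization := \pi x.

Lemma ab_classP x y : ab_class x = ab_class y <-> derived (x^-1 * y).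
Proof.
split=> [/eqquotP/asboolP//|xy].
by apply/eqquotP/asboolP.
Qed.

Lemma ab_class_repr (x : abelianization) : ab_class (repr x) = x.
Proof. exact: reprK. Qed.

Lemma derived_repr x : derived ((repr (ab_class x))^-1 * x).
Proof. by apply/ab_classP; rewrite ab_class_repr. Qed.

Definition abel_add (x y : abelianization) := ab_class (repr x * repr y).
Definition abel_opp (x : abelianization) := ab_class (repr x)^-1.

Lemma ab_class_addE x y : abel_add (ab_class x) (ab_class y) = ab_class (x * y).
Proof.
apply/ab_classP; rewrite invgM -mulgA (mulgA _ x).
have dx := derived_repr x; have dy := derived_repr y.
have := derived_mul (derivedJ (repr (ab_class y)) dx) dy.
by rewrite conjgE !mulgA mulgK.
Qed.

Lemma ab_class_oppE x : abel_opp (ab_class x) = ab_class x^-1.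
Proof.
apply/ab_classP; rewrite invgK.
have := derivedJ x^-1 (derived_inv (derived_repr x)).
by rewrite conjgE invgK invgM invgK !mulgA mulgV mul1g.
Qed.

Fact abel_addA : associative abel_add.
Proof.
move=> x y z; rewrite -[x]ab_class_repr -[y]ab_class_repr -[z]ab_class_repr.
by rewrite !ab_class_addE mulgA.
Qed.

Fact abel_addC : commutative abel_add.
Proof.
move=> x y; rewrite -[x]ab_class_repr -[y]ab_class_repr !ab_class_addE.
apply/ab_classP; rewrite invgM -mulgA; exact: derived_comm.
Qed.

Fact abel_add0 : left_id (ab_class 1) abel_add.
Proof. by move=> x; rewrite -[x]ab_class_repr ab_class_addE mul1g. Qed.

Fact abel_addN : left_inverse (ab_class 1) abel_opp abel_add.
Proof.
by move=> x; rewrite -[x]ab_class_repr ab_class_oppE ab_class_addE mulVg.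
Qed.

HB.instance Definition _ :=
  GRing.isZmodule.Build abelianization abel_addA abel_addC abel_add0 abel_addN.

Lemma ab_classM x y : ab_class (x * y) = (ab_class x + ab_class y)%R.
Proof. by rewrite -ab_class_addE. Qed.

Lemma ab_class1 : ab_class 1 = 0%R.
Proof. by []. Qed.

End Abelianization.

Section AbelianizationMaps.
Local Open Scope group_scope.

Lemma derived_map (G H : groupType) (f : group_hom G H) (x : G) :
  derived x -> derived (f x).
Proof.
elim=> {x} [x y|x y _ fx _ fy|x _ fx].
- by rewrite gmulfR; apply: derived_comm.
- by rewrite gmulfM; apply: derived_mul.
- by rewrite gmulfV; apply: derived_inv.
Qed.

Section Lift.
Variables (G : groupType) (B : zmodType) (f : G -> B).
Hypothesis fM : forall x y, f (x * y) = (f x + f y)%R.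

Lemma to_ab1 : f 1 = 0%R.
Proof. by apply: (addrI (f 1)); rewrite -fM mulg1 addr0. Qed.

Lemma to_abV x : f x^-1 = (- f x)%R.
Proof. by apply/eqP; rewrite -addr_eq0 -fM mulVg to_ab1. Qed.

Lemma to_ab_derived x : derived x -> f x = 0%R.
Proof.
elim=> {x} [x y|x y _ fx _ fy|x _ fx].
- by rewrite !fM !to_abV [in X in (_ + X)%R]addrCA addKr addNr.
- by rewrite fM fx fy addr0.
- by rewrite to_abV fx oppr0.
Qed.

Let lift (x : abelianization G) : B := f (repr x).

Let liftE x : lift (ab_class x) = f x.
Proof.
have := to_ab_derived (derived_repr x).
by rewrite fM to_abV addrC => /eqP; rewrite subr_eq0 => /eqP.
Qed.

Fact ab_lift_additive : zmod_morphism lift.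
Proof.
move=> x y; rewrite -[x]ab_class_repr -[y]ab_class_repr.
rewrite -[(- ab_class _)%R]/(abel_opp _) ab_class_oppE -ab_classM !liftE.
by rewrite fM to_abV.
Qed.

Definition ab_lift : {additive abelianization G -> B} :=
  HB.pack lift
    (GRing.isZmodMorphism.Build (abelianization G) B lift ab_lift_additive).

Lemma ab_liftE x : ab_lift (ab_class x) = f x.
Proof. exact: liftE. Qed.

End Lift.

Variables (G H : groupType) (f : group_hom G H).

Fact ab_mapM x y : ab_class (f (x * y)) = (ab_class (f x) + ab_class (f y))%R.
Proof. by rewrite gmulfM ab_classM. Qed.

Definition ab_map : {additive abelianization G -> abelianization H} :=
  ab_lift ab_mapM.

Lemma ab_mapE x : ab_map (ab_class x) = ab_class (f x).
Proof. exact: ab_liftE. Qed.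

End AbelianizationMaps.

Definition mulgroup (B : zmodType) : Type := B.

Section MulGroup.
Variable B : zmodType.
HB.instance Definition _ := Choice.on (mulgroup B).
HB.instance Definition _ :=
  isGroup.Build (mulgroup B) (@addrA B) (@add0r B) (@addr0 B)
    (@addNr B) (@addrN B).
End MulGroup.

Lemma abelianization_free (G : gr_obj) :
  exists (I : finType) (x : I -> abelianization G), free_abelian_basis x.
Proof.
have [I [x xfree]] := gr_free G; exists I, (fun i => ab_class (x i)) => B y.
have [f [fx f_uniq]] := xfree (mulgroup B) y.
have fM a b : (f : G -> B) (a * b)%g = f a + f b by rewrite gmulfM.
exists (ab_lift fM); split=> [i|g gx]; first by rewrite ab_liftE fx.
have g_mor : monoid.monoid_morphism
    ((g : abelianization G -> mulgroup B) \o @ab_class G).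
  by split=> [|a b]; rewrite /= ?ab_class1 ?raddf0 // ab_classM raddfD.
pose g' : group_hom G (mulgroup B) :=
  HB.pack ((g : abelianization G -> mulgroup B) \o @ab_class G)
    (isUMagmaMorphism.Build G (mulgroup B) _ g_mor).
have fg' : f = g' by apply: f_uniq => i; apply: gx.
apply: additive_ext => a; rewrite -[a]ab_class_repr ab_liftE.
by rewrite fg'.
Qed.

Definition Ab_obj (G : gr) : ab := AbObj (abelianization_free G).
Definition Ab_map (G H : gr) (f : hom G H) : hom (Ab_obj G) (Ab_obj H) :=
  ab_map f.

Fact Ab_map1 G : Ab_map (idm G) = idm (Ab_obj G).
Proof.
by apply: additive_ext => x; rewrite -[x]ab_class_repr /Ab_map ab_mapE.
Qed.

Fact Ab_mapM G H K (g : hom H K) (f : hom G H) :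
  Ab_map (comp g f) = comp (Ab_map g) (Ab_map f).
Proof.
apply: additive_ext => x; rewrite -[x]ab_class_repr /Ab_map.
apply: (etrans (ab_mapE _ _)); apply: esym.
by apply: (etrans (congr1 (ab_map g) (ab_mapE _ _))); rewrite ab_mapE.
Qed.

Definition Ab : functor gr ab := @Functor gr ab Ab_obj Ab_map Ab_map1 Ab_mapM.

Definition ring_isomorphic (R S : pzRingType) : Prop :=
  exists f : {rmorphism R -> S}, bijective f.

Definition prime_field (k : comNzRingType) : Prop :=
  ring_isomorphic k rat \/ exists2 p : nat, prime p & ring_isomorphic k 'F_p.

(* Main.v *)
(** If [A] is free on [I], then Hom(A, X) is the group X^I, so every [y : F A]
    gives a function phi on X^I with values in [F X]. Let K_m(X) be the
    submodule of [F X] spanned by the m-fold deviations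
    ((a_1 - 1) ... (a_m - 1) h) phi of all these functions; on the projective
    generators X |-> k[X^I] of Fct(gr, k-Mod) this is the filtration by the
    powers of the augmentation ideal. Expanding the identity of a free product
    along its factors shows that F / K_m has degree less than m, and
    conversely K_m vanishes if F has degree less than m. Modulo K_(m+1), an
    m-fold deviation does not depend on h and is additive in each a_i; hence
    K_m / K_(m+1) does not see commutators, and factors through the
    abelianization because the latter is full and essentially surjective. The
    filtration F_i := K_(n-i) has the required properties. *)

From HB Require Import structures.
From mathcomp Require Import all_boot all_order all_algebra.
From mathcomp Require Import boolp.
Require Import Defs.

Set Implicit Arguments.
Unset Strict Implicit.
Unset Printing Implicit Defensive.

Import GRing.Theory.

(** * Deviations of functions on a group *)

Section Deviations.
Local Open Scope ring_scope.

Section Dev.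
Variables (k : pzRingType) (V : lmodType k) (P : groupType).
Implicit Types (phi : P -> V) (s : seq P) (h : P).

(** With [phi] extended linearly to the group ring, this is its value at (a_m - 1) ... (a_1 - 1) h
    for [s] = a_1, ..., a_m: the head of the list stands next to [h]. *)
Fixpoint dev phi s h : V :=
  if s is a :: s' then dev phi s' (a * h)%g - dev phi s' h else phi h.

Lemma dev1 phi s h : 1%g \in s -> dev phi s h = 0.
Proof.
elim: s h => //= a s IHs h; rewrite inE => /orP[/eqP <-|s1].
  by rewrite mul1g subrr.
by rewrite !IHs // subrr.
Qed.

(** Comes from ba - 1 = (b - 1) + (a - 1) + (b - 1)(a - 1) in the group ring. *)
Lemma dev_mul phi s1 s2 a b h :
  dev phi (s1 ++ (b * a)%g :: s2) h =
  dev phi (s1 ++ b :: s2) h + dev phi (s1 ++ a :: s2) h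
  + dev phi (s1 ++ [:: a, b & s2]) h.
Proof.
elim: s1 h => [|c s1 IHs] h /=; last first.
  by rewrite !IHs !opprD addrACA [X in X + _ = _]addrACA.
rewrite mulgA; set X := dev phi s2 (b * h)%g - _.
by rewrite addrA [RHS]addrC -(addrA X) addKr addrC addrA subrK.
Qed.

(** Comes from (a - 1) h = (ah - 1) - (h - 1); it moves the base point of a deviation of positive
    order to 1. *)
Lemma dev_shift_base phi a s h :
  dev phi (a :: s) h = dev phi ((a * h)%g :: s) 1%g - dev phi (h :: s) 1%g.
Proof. by rewrite /= !mulg1 opprB addrA subrK. Qed.

Section TopDeviations.
Variables (phi : P -> V) (W : submodClosed V) (m : nat).
Hypothesis phiW : forall s h, size s = m.+1 -> dev phi s h \in W.

(** Since h - h' = (h h'^-1 - 1) h', the difference is a deviation of order [m.+1]. *)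
Lemma top_dev_const s h h' :
  size s = m -> qproj W (dev phi s h) = qproj W (dev phi s h').
Proof.
move=> sm; apply/qprojP.
have := phiW (s := (h * h'^-1)%g :: s) h'; rewrite /= sm mulgVK.
by apply.
Qed.

(* A deviation of order [m] is additive modulo [W] in each direction, hence
   only depends on the classes of the directions modulo commutators. *)
Lemma top_dev_derived s1 s2 a b h :
  size (s1 ++ a :: s2) = m -> derived (a^-1 * b)%g ->
  qproj W (dev phi (s1 ++ a :: s2) h) = qproj W (dev phi (s1 ++ b :: s2) h).
Proof.
move=> sm; pose f c := qproj W (dev phi (s1 ++ c :: s2) h).
have fM x y : f (x * y)%g = f x + f y.
  rewrite /f dev_mul -linearD; apply/qprojP; rewrite addrC addKr.
  by apply: phiW; rewrite -sm !size_cat /= !addnS.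
move=> /(to_ab_derived fM); rewrite fM (to_abV fM) addrC => /eqP.
by rewrite subr_eq0 => /eqP.
Qed.

Lemma top_dev_map_derived (T : Type) (f g : T -> P) (t : seq T) h h' :
  (forall a, derived ((f a)^-1 * g a)%g) -> size t = m ->
  qproj W (dev phi (map f t) h) = qproj W (dev phi (map g t) h').
Proof.
(* The directions are replaced one at a time; [s1] holds those already replaced. *)
move=> fg tm; suff fgt s1 : (size s1 + size t)%N = m ->
    qproj W (dev phi (s1 ++ map f t) h) = qproj W (dev phi (s1 ++ map g t) h).
  by rewrite (fgt [::]) //; apply: top_dev_const; rewrite size_map.
elim: t s1 {tm} => //= a t IHt s1 sm.
rewrite (top_dev_derived _ _ (fg a)) ?size_cat /= ?size_map //.
by rewrite -!cat_rcons IHt // size_rcons addSnnS.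
Qed.

End TopDeviations.
End Dev.

Lemma dev_comp (k : pzRingType) (V W : lmodType k) (P Q : groupType)
    (theta : {linear V -> W}) (tau : group_hom P Q) (phi : P -> V)
    (psi : Q -> W) s h :
  (forall a, theta (phi a) = psi (tau a)) ->
  theta (dev phi s h) = dev psi (map tau s) (tau h).
Proof.
by move=> e; elim: s h => //= a s IHs h; rewrite linearB !IHs gmulfM.
Qed.

End Deviations.

(** * Finite powers of a group *)

Section PowerGroups.

Section PointwiseMap.
Variables (I : finType) (G H : groupType) (f : group_hom G H).

Let map (y : {ffun I -> G}) : {ffun I -> H} := [ffun i => f (y i)].

Fact ffun_map_mor : monoid.monoid_morphism map.
Proof.
split=> [|y z]; apply/ffunP => i; rewrite !ffunE; first exact: gmulf1.
exact: gmulfM.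
Qed.

Definition ffun_map : group_hom {ffun I -> G} {ffun I -> H} :=
  HB.pack map (isUMagmaMorphism.Build _ _ map ffun_map_mor).

Lemma ffun_mapE y i : ffun_map y i = f (y i).
Proof. by rewrite [LHS]ffunE. Qed.

End PointwiseMap.

Section PointwiseInjection.
Variables (I : finType) (G : groupType) (i : I).

Let inj (a : G) : {ffun I -> G} := [ffun j => if j == i then a else 1%g].

Fact ffun_inj_mor : monoid.monoid_morphism inj.
Proof.
split=> [|a b]; apply/ffunP => j; rewrite !ffunE; case: ifP => //.
by rewrite mulg1.
Qed.

Definition ffun_inj : group_hom G {ffun I -> G} :=
  HB.pack inj (isUMagmaMorphism.Build _ _ inj ffun_inj_mor).

End PointwiseInjection.

(** As [I] is finite, [y] is a finite product of its coordinates placed by [ffun_inj], and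
    homomorphisms preserve derived elements. *)
Lemma derived_ffun (I : finType) (G : groupType) (y : {ffun I -> G}) :
  (forall i, derived (y i)) -> derived y.
Proof.
move=> dy; pose res (r : seq I) : {ffun I -> G} :=
  [ffun i => if i \in r then y i else 1%g].
have -> : y = res (enum I) by apply/ffunP => i; rewrite ffunE mem_enum.
elim: (enum I) => [|i r IHr].
  have -> : res [::] = 1%g by apply/ffunP => i; rewrite !ffunE.
  exact: derived1.
case ir: (i \in r).
  suff -> : res (i :: r) = res r by [].
  by apply/ffunP => j; rewrite !ffunE inE; case: eqP => [->|] //=; rewrite ir.
have -> : res (i :: r) = (ffun_inj G i (y i) * res r)%g.
  apply/ffunP => j; rewrite !ffunE inE; case: eqP => [->|] /=.
    by rewrite ir mulg1.
  by rewrite mul1g.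
exact: derived_mul (derived_map _ (dy i)) IHr.
Qed.

End PowerGroups.

(** * Free groups and bases of free products *)

Section FreeGroups.
Local Open Scope group_scope.

Section Lift.
Variables (G : groupType) (I : Type) (x : I -> G).
Hypothesis x_basis : free_group_basis x.

Definition free_lift (H : groupType) (y : I -> H) : group_hom G H :=
  sval (cid (x_basis y)).

Lemma free_liftE (H : groupType) (y : I -> H) i : free_lift y (x i) = y i.
Proof. exact: (svalP (cid (x_basis y))).1. Qed.

Lemma free_lift_uniq (H : groupType) (f : group_hom G H) :
  free_lift (f \o x) = f.
Proof. exact: (svalP (cid (x_basis (f \o x)))).2. Qed.

Lemma free_hom_ext (H : groupType) (f g : group_hom G H) :
  (forall i, f (x i) = g (x i)) -> f = g.
Proof.
move=> fg; rewrite -[f]free_lift_uniq -[g]free_lift_uniq.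
by congr free_lift; apply/funext.
Qed.

End Lift.

Lemma freeprod_hom_ext (I : finType) (A : I -> groupType) (H : groupType)
    (f g : group_hom (freeprod A) H) :
  (forall i a, f (fp_inj A i a) = g (fp_inj A i a)) -> f = g.
Proof.
move=> fg; pose fi i := group_comp f (fp_inj A i).
have -> : g = fp_copair fi by apply: fp_copair_uniq => i a; rewrite -fg.
exact: fp_copair_uniq.
Qed.

(** [freeprod_free] hides its basis; the expansion along the factors needs one that is explicit and
    adapted to them. *)
Lemma freeprod_basis (I : finType) (A : I -> groupType) (J : I -> Type)
    (x : forall i, J i -> A i) :
  (forall i, free_group_basis (x i)) ->
  free_group_basis
    (fun j : {i : I & J i} => fp_inj A (tag j) (x (tag j) (tagged j))).
Proof.
move=> xb H y.
exists (fp_copair (fun i => free_lift (xb i) (fun j => y (Tagged J j)))).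
split=> [[i j]|g gy]; first by rewrite fp_copair_inj free_liftE.
apply: freeprod_hom_ext => i a; rewrite fp_copair_inj.
suff -> : free_lift (xb i) (fun j => y (Tagged J j)) =
  group_comp g (fp_inj A i) by [].
by apply: (free_hom_ext (xb i)) => j; rewrite free_liftE -(gy (Tagged J j)).
Qed.

Section IntPower.
Variables (H : groupType) (y : H).

Definition int_power (n : int) : H :=
  match n with Posz n => y ^+ n | Negz n => y ^- n.+1 end.

Lemma int_powerS n : int_power (n + 1)%R = int_power n * y.
Proof.
case: n => [n|[|n]].
- by rewrite -[(_ + 1)%R]/(Posz (n + 1)) addn1 /= expgSr.
- by rewrite /= expg1 mulVg.
have -> : (Negz n.+1 + 1)%R = Negz n.
  by rewrite !NegzE -addn1 PoszD opprD addrNK.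
by rewrite /= (expgS _ n.+1) invgM mulgVK.
Qed.

Lemma int_powerM : {morph int_power : m n / (m + n)%R >-> m * n}.
Proof.
move=> m; elim/int_rect => [|n IHn|n IHn]; first by rewrite addr0 mulg1.
  by rewrite -addn1 PoszD addrA !int_powerS IHn mulgA.
apply: (mulIg y); rewrite -mulgA -!int_powerS -addrA.
by rewrite -addn1 PoszD opprD addrNK IHn.
Qed.

Fact int_power_mor : monoid.monoid_morphism (int_power : mulgroup int -> H).
Proof. by split=> //; apply: int_powerM. Qed.

Definition int_power_hom : group_hom (mulgroup int) H :=
  HB.pack (int_power : mulgroup int -> H)
    (isUMagmaMorphism.Build (mulgroup int) H _ int_power_mor).

End IntPower.

Lemma mulgroup_int_basis :
  free_group_basis (fun _ : unit => 1%R : mulgroup int).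
Proof.
move=> H y; exists (int_power_hom (y tt)).
split=> [[]|f fy]; first exact: expg1.
apply: group_hom_ext => n.
have f1 : f (1%R : mulgroup int) = y tt by apply: fy.
have fS (m : int) : f (m + 1)%R = f m * y tt.
  by rewrite -f1; apply: gmulfM.
rewrite -[LHS]/(int_power (y tt) n).
elim/int_rect: n => [|n IHn|n IHn]; first by apply/esym/(gmulf1 (s := f)).
  by rewrite -addn1 PoszD int_powerS fS IHn.
apply: (mulIg (y tt)); rewrite -int_powerS -fS.
by rewrite -addn1 PoszD opprD addrNK IHn.
Qed.

Definition gr_int : gr :=
  GrObj (gr_group := mulgroup int)
    (ex_intro _ (unit : finType) (ex_intro _ _ mulgroup_int_basis)).

(** A free product of copies of the integers; it serves to reach every object of [ab] up to
    isomorphism. *)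
Lemma exists_free_group (I : finType) :
  exists (X : gr) (x : I -> gr_group X), free_group_basis x.
Proof.
have b := freeprod_basis (fun _ : I => mulgroup_int_basis).
exists (gr_freeprod (fun _ : I => gr_int)).
exists (fun i => fp_inj _ i (1%R : mulgroup int)) => H y.
have [f [fy f_uniq]] := b H (y \o tag).
exists f; split=> [i|g gy]; first exact: (fy (Tagged _ tt)).
by apply: f_uniq => -[i []]; apply: gy.
Qed.

End FreeGroups.

(** * Fullness and essential surjectivity of abelianization *)

Section AbelianizationQuotient.
Local Open Scope ring_scope.

Lemma ab_map_eq_derived (X Y : gr) (f g : group_hom X Y) :
  ab_map f = ab_map g -> forall a, derived ((f a)^-1 * g a)%g.
Proof. by move=> fg a; apply/ab_classP; rewrite -!ab_mapE fg. Qed.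

Lemma ab_hom_ext (G : groupType) (B : zmodType)
    (u v : {additive abelianization G -> B}) :
  (forall a, u (ab_class a) = v (ab_class a)) -> u = v.
Proof. by move=> uv; apply: additive_ext => a; rewrite -[a]ab_class_repr. Qed.

Section AbUnlift.
Variables (G : groupType) (B : zmodType) (u : {additive abelianization G -> B}).

Let unlift : G -> mulgroup B := u \o @ab_class G.

Fact ab_unlift_mor : monoid.monoid_morphism unlift.
Proof.
split=> [|a b]; rewrite /unlift /= ?ab_class1 ?raddf0 //.
by rewrite ab_classM raddfD.
Qed.

Definition ab_unlift : group_hom G (mulgroup B) :=
  HB.pack unlift (isUMagmaMorphism.Build G (mulgroup B) unlift ab_unlift_mor).

End AbUnlift.

Lemma free_ab_hom_ext (G : groupType) (I : Type) (x : I -> G) (B : zmodType)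
    (u v : {additive abelianization G -> B}) :
  free_group_basis x ->
  (forall i, u (ab_class (x i)) = v (ab_class (x i))) -> u = v.
Proof.
move=> xb uv; apply: ab_hom_ext => a.
suff e : ab_unlift u = ab_unlift v.
  exact: (congr1 (fun f : group_hom _ _ => f a) e).
exact: (free_hom_ext xb).
Qed.

(** The values of [u] on a basis of [X] are lifted arbitrarily to [G], and freeness extends the
    lift. *)
Lemma ab_map_surj (X : gr) (G : groupType)
    (u : {additive abelianization X -> abelianization G}) :
  exists f : group_hom X G, ab_map f = u.
Proof.
have [I [x xb]] := gr_free X.
exists (free_lift xb (fun i => repr (u (ab_class (x i))))).
by apply: (free_ab_hom_ext xb) => i; rewrite ab_mapE free_liftE ab_class_repr.
Qed.

(** [X] is free on the index set of a basis of [B]; the maps exchanging the two bases are mutually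
    inverse, by uniqueness on bases. *)
Lemma Ab_essentially_surjective (B : ab) :
  exists (X : gr) (u : hom (Ab X) B), is_iso u.
Proof.
have [I [b bb]] := ab_free B; have [X [x xb]] := exists_free_group I.
exists X; pose f := free_lift xb (b : I -> mulgroup B).
have fM a c : (f : X -> B) (a * c)%g = f a + f c by rewrite gmulfM.
have [v [vb _]] := bb _ (fun i => ab_class (x i)).
exists (ab_lift fM), v; split.
  apply: (free_ab_hom_ext xb) => i.
  by apply: etrans (congr1 v (ab_liftE fM _)) _; rewrite free_liftE vb.
have [w [_ w_uniq]] := bb _ b.
apply: etrans (esym (w_uniq _ _)) (w_uniq (add_id B) _) => // i.
apply: etrans (congr1 (ab_lift fM) (vb i)) _.
by rewrite ab_liftE free_liftE.
Qed.

End AbelianizationQuotient.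

(** * Factorization through abelianization and through projections of free products *)

Section Factorization.
Variables (C D E : category) (P : functor C D) (T : functor C E).
Hypothesis P_full : forall (X Y : C) (u : hom (P X) (P Y)),
  exists f : hom X Y, fmap P f = u.
Hypothesis P_ess_surj : forall B : D,
  exists (X : C) (u : hom (P X) B), is_iso u.
Hypothesis T_cong : forall (X Y : C) (f g : hom X Y),
  fmap P f = fmap P g -> fmap T f = fmap T g.

Let lift (X Y : C) (u : hom (P X) (P Y)) : hom X Y := sval (cid (P_full u)).

Let liftE X Y (u : hom (P X) (P Y)) : fmap P (lift u) = u.
Proof. exact: svalP (cid (P_full u)). Qed.

(** [lift] is a mere choice and need not be functorial; by [T_cong] its image under [T] is
    independent of the choice, hence functorial. *)
Let Tl (X Y : C) (u : hom (P X) (P Y)) : hom (T X) (T Y) := fmap T (lift u).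

Let Tl_fmap X Y (f : hom X Y) : Tl (fmap P f) = fmap T f.
Proof. by apply: T_cong; rewrite liftE. Qed.

Let TlM X Y Z (v : hom (P Y) (P Z)) (u : hom (P X) (P Y)) :
  Tl (comp v u) = comp (Tl v) (Tl u).
Proof. by rewrite /Tl -fmapM; apply: T_cong; rewrite fmapM !liftE. Qed.

Let Tl1 X : Tl (idm (P X)) = idm (T X).
Proof. by rewrite -fmap1 Tl_fmap fmap1. Qed.

Let rep (B : D) : C := sval (cid (P_ess_surj B)).
Let rep_hom (B : D) : hom (P (rep B)) B :=
  sval (cid (svalP (cid (P_ess_surj B)))).
Let rep_iso B : is_iso (rep_hom B).
Proof. exact: svalP (cid (svalP (cid (P_ess_surj B)))). Qed.
Let rep_inv (B : D) : hom B (P (rep B)) := sval (cid (rep_iso B)).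
Let rep_homK B : comp (rep_inv B) (rep_hom B) = idm _.
Proof. exact: (svalP (cid (rep_iso B))).1. Qed.
Let rep_invK B : comp (rep_hom B) (rep_inv B) = idm _.
Proof. exact: (svalP (cid (rep_iso B))).2. Qed.

Let ext_map (A B : D) (u : hom A B) : hom (T (rep A)) (T (rep B)) :=
  Tl (comp (rep_inv B) (comp u (rep_hom A))).

Let ext1 A : ext_map (idm A) = idm _.
Proof. by rewrite /ext_map comp1m rep_homK Tl1. Qed.

Let extM A B B' (v : hom B B') (u : hom A B) :
  ext_map (comp v u) = comp (ext_map v) (ext_map u).
Proof.
rewrite /ext_map -TlM; congr Tl; rewrite -!compA.
by congr comp; congr comp; rewrite [RHS]compA rep_invK comp1m.
Qed.

Lemma full_ess_surj_factor : in_precomp_essential_image P T.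
Proof.
exists (@Functor D E (T \o rep) ext_map ext1 extM).
exists (fun X => Tl (rep_hom (P X))); split=> [X Y f|X].
  rewrite /= /ext_map -Tl_fmap -!TlM; congr Tl.
  by rewrite compA rep_invK comp1m.
exists (Tl (rep_inv (P X))).
by rewrite -!TlM rep_homK rep_invK !Tl1.
Qed.

End Factorization.

Lemma precomp_Ab_essential_image (E : category) (T : functor gr E) :
  (forall (X Y : gr) (f g : hom X Y),
     (forall a : gr_group X,
        derived (((f : group_hom X Y) a)^-1 * (g : group_hom X Y) a)%g) ->
     fmap T f = fmap T g) ->
  in_precomp_essential_image Ab T.
Proof.
move=> Tfg; apply: full_ess_surj_factor.
- by move=> X Y u; apply: ab_map_surj.
- exact: Ab_essentially_surjective.
- by move=> X Y f g /ab_map_eq_derived; apply: Tfg.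
Qed.

(** [g] is [f] on the remaining factors. This will apply to the terms of an expansion that miss the
    factor [i]. *)
Lemma fp_kill_factor (I : finType) (A : I -> gr) (X : gr) (i : I)
    (f : group_hom (freeprod A) X) :
  (forall a, f (fp_inj A i a) = 1%g) ->
  exists g : hom (gr_freeprod (fun j : {j : I | j != i} => A (val j))) X,
    f = comp g (fp_kill A i).
Proof.
move=> fi.
pose A' (j : {j : I | j != i}) : groupType := A (val j).
pose g := fp_copair (A := A') (fun j => group_comp f (fp_inj A (val j))).
exists g; apply: freeprod_hom_ext => j a; apply/esym.
case: (eqVneq j i) a => [->|ji] a.
  by apply: etrans (congr1 g (fp_kill_inj1 a)) _; rewrite fi; apply: gmulf1.
apply: etrans (congr1 g (fp_kill_inj ji a)) _.
exact: (fp_copair_inj (A := A')).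
Qed.

(** * The filtration by deviations and its subquotients *)

Section Filtration.
Local Open Scope ring_scope.
Variables (k : pzRingType) (F : functor gr (kMod k)).

Section Action.
Variables (A : gr) (I : finType) (x : I -> gr_group A).
Hypothesis xb : free_group_basis x.

(* Through the basis [x], the homomorphisms from [A] to [X] form the group
   [X ^ I]; [act_on y] linearises the action of the latter on [y]. *)
Definition act_on (y : fmod F A) (X : gr) (h : {ffun I -> gr_group X}) :
  fmod F X := fmor F (free_lift xb h : hom A X) y.

Lemma act_on_nat y (X Y : gr) (f : hom X Y) h :
  fmor F f (act_on y h) = act_on y (ffun_map I f h).
Proof.
rewrite /act_on -[LHS](@fmorM _ _ F _ _ _ f (free_lift xb h : hom A X) y).
congr (fmor F _ y).
by apply: (free_hom_ext xb) => i; rewrite free_liftE ffun_mapE /= free_liftE.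
Qed.

Lemma act_on_basis y : act_on y [ffun i => x i] = y.
Proof.
rewrite /act_on -[RHS]fmor1; congr (fmor F _ y).
by apply: (free_hom_ext xb) => i; rewrite free_liftE ffunE.
Qed.

Lemma dev_act_on_nat y (X Y : gr) (f : hom X Y) s h :
  fmor F f (dev (act_on y (X := X)) s h) =
  dev (act_on y (X := Y)) (map (ffun_map I f) s) (ffun_map I f h).
Proof. by apply: dev_comp => a; apply: act_on_nat. Qed.

End Action.

(** This is K_m(X). All bases of all [A] are allowed, as objects carry no chosen one; the inductive
    form lets properties be checked on generators. *)
Inductive in_dev_filtration (m : nat) (X : gr) : fmod F X -> Prop :=
| in_dev_dev (A : gr) (I : finType) (x : I -> gr_group A)
    (xb : free_group_basis x) (y : fmod F A) s h :
    size s = m -> in_dev_filtration m (dev (act_on xb y (X := X)) s h)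
| in_dev0 : in_dev_filtration m 0
| in_dev_lin a u v : in_dev_filtration m u -> in_dev_filtration m v ->
    in_dev_filtration m (a *: u + v).

Section At.
Variables (m : nat) (X : gr).

Definition dev_pred : {pred fmod F X} := fun u => `[< in_dev_filtration m u >].

Fact dev_pred_closed : submod_closed dev_pred.
Proof.
split=> [|a u v /asboolP um /asboolP vm]; apply/asboolP; first exact: in_dev0.
exact: in_dev_lin.
Qed.

HB.instance Definition _ :=
  GRing.isSubmodClosed.Build k (fmod F X) dev_pred dev_pred_closed.

End At.

Arguments dev_pred m X : clear implicits.

Fact dev_pred_stable m (X Y : gr) (f : hom X Y) (u : fmod F X) :
  u \in dev_pred m X -> fmor F f u \in dev_pred m Y.
Proof.
move=> /asboolP um; apply/asboolP.
elim: {u} um => [A I x xb y s h sm||a u v _ IHu _ IHv].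
- by rewrite dev_act_on_nat; apply: in_dev_dev; rewrite size_map.
- by rewrite linear0; apply: in_dev0.
- by rewrite linearP; apply: in_dev_lin.
Qed.

Definition dev_filtration m : subfunctor F :=
  @Subfunctor k gr F (fun X => dev_pred m X) (@dev_pred_stable m).

Lemma dev_filtrationP m (X : gr) (u : fmod F X) :
  reflect (in_dev_filtration m u) (u \in dev_filtration m X).
Proof. exact: asboolP. Qed.

(** A deviation without directions is a value of the function, and [act_on xb u] takes the value [u]
    at the basis itself. *)
Lemma dev_filtration0 (X : gr) (u : fmod F X) : u \in dev_filtration 0 X.
Proof.
have [I [x xb]] := gr_free X; apply/dev_filtrationP.
rewrite -(act_on_basis xb u); exact: (in_dev_dev xb u (s := [::])).
Qed.

Lemma dev_filtrationS m (X : gr) (u : fmod F X) :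
  u \in dev_filtration m.+1 X -> u \in dev_filtration m X.
Proof.
move=> /dev_filtrationP um; apply/dev_filtrationP.
elim: {u} um => [A I x xb y [|a s] //= h [sm]||a u v _ IHu _ IHv].
- by rewrite addrC -scaleN1r; apply: in_dev_lin; apply: in_dev_dev.
- exact: in_dev0.
- exact: in_dev_lin.
Qed.

(* A deviation of order [d.+1] is the image, under a fold map, of an element of
   the cross effect of the free product of [d.+1] copies of [A]. *)
Lemma dev_filtration_polynomial d (X : gr) (u : fmod F X) :
  polynomial_functor F d -> u \in dev_filtration d.+1 X -> u = 0.
Proof.
move=> Fd /dev_filtrationP.
elim=> {u} [A I x xb y s h sd|//|a u v _ -> _ ->]; last first.
  by rewrite scaler0 addr0.
(* Base point 1 first, because a fold map sends 1 to 1; [dev_shift_base] then gives all base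
   points. *)
have dev_1 t : size t = d.+1 -> dev (act_on xb y (X := X)) t 1%g = 0.
  move=> /eqP td; pose T := Tuple td.
  pose A' := fun _ : 'I_d.+1 => A; pose B := gr_freeprod A'.
  pose in_ i : {ffun I -> gr_group B} := [ffun j => fp_inj A' i (x j)].
  pose t0 := [seq in_ i | i <- enum 'I_d.+1].
  pose z : fmod F B := dev (act_on xb y (X := B)) t0 1%g.
  have z0 : z = 0.
    (* Killing the copy [i] turns the direction [in_ i] into 1, which annihilates the deviation. *)
    apply: Fd => i; rewrite /z dev_act_on_nat dev1 //; apply/mapP.
    exists (in_ i); first by apply: map_f; rewrite mem_enum.
    apply/ffunP => j; rewrite [LHS]ffunE; apply/esym.
    apply: etrans (ffun_mapE _ _ _) _; rewrite ffunE.
    exact: (fp_kill_inj1 (A := A')).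
  pose g : hom B X := fp_copair (fun i => free_lift xb (tnth T i)).
  have <- : fmor F g z = dev (act_on xb y (X := X)) t 1%g; last first.
    by rewrite z0 linear0.
  rewrite /z dev_act_on_nat (gmulf1 (s := ffun_map I g)); congr (dev _ _ _).
  rewrite -[RHS](map_tnth_enum T) -map_comp; apply: eq_map => i.
  apply/ffunP => j; apply: etrans (ffun_mapE _ _ _) _; rewrite ffunE.
  by rewrite -(free_liftE xb (tnth T i)); apply: fp_copair_inj.
case: s sd => // a s [sd].
by rewrite dev_shift_base !dev_1 ?subrr //= sd.
Qed.

(** On a generator, [f] and [g] give deviations of one function whose directions agree
    coordinatewise modulo commutators, so [top_dev_map_derived] applies with K_(m+1) as [W]. *)
Lemma dev_filtration_derived m (X Y : gr) (f g : group_hom X Y) (u : fmod F X) :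
  (forall a, derived ((f a)^-1 * g a)%g) -> u \in dev_filtration m X ->
  fmor F (f : hom X Y) u - fmor F (g : hom X Y) u \in dev_filtration m.+1 Y.
Proof.
move=> fg /dev_filtrationP um; apply/qprojP.
elim: {u} um => [A I x xb y s h sm||a u v _ IHu _ IHv].
- rewrite !dev_act_on_nat; apply: (@top_dev_map_derived _ _ _ _ _ m) => //.
    by move=> t h' tm; apply/dev_filtrationP; apply: in_dev_dev.
  by move=> c; apply: derived_ffun => i; rewrite !ffunE; apply: fg.
- by rewrite !linear0.
- rewrite 2!(linearP (fmor F _)) 2!(linearP (qproj _)).
  by congr (_ *: _ + _); [apply: IHu | apply: IHv].
Qed.

(* [u] is the value of [phi] on the basis [b], the product of its restrictions
   [res [:: i]] to the factors; every other term in the expansion of the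
   deviation of [phi] along these restrictions factors through some
   [fp_kill A i]. *)
Lemma dev_filtration_cross_effect m (I : finType) (A : I -> gr)
    (u : fmod F (gr_freeprod A)) :
  #|I| = m ->
  (forall i, fmor F (fp_kill A i) u \in dev_filtration m _) ->
  u \in dev_filtration m (gr_freeprod A).
Proof.
move=> Im killu; set W := dev_filtration m (gr_freeprod A).
have /choice[J JP] i : exists J : finType, exists x : J -> gr_group (A i),
    free_group_basis x.
  exact: gr_free.
pose x i := sval (cid (JP i)).
have xb i : free_group_basis (x i) := svalP (cid (JP i)).
pose b (j : {i : I & J i}) : gr_freeprod A :=
  fp_inj A (tag j) (x (tag j) (tagged j)).
have bb : free_group_basis b := freeprod_basis xb.
pose phi := act_on (A := gr_freeprod A) bb u (X := gr_freeprod A).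
pose res (r : seq I) : {ffun {i : I & J i} -> freeprod A} :=
  [ffun j => if tag j \in r then b j else 1%g].
(* The homomorphism defined by [res r] is trivial on the factor [i], so it factors through
   [fp_kill A i], where [killu] applies. *)
have resW r i : i \notin r -> phi (res r) \in W.
  move=> ir; rewrite /phi /act_on.
  have [a|g ->] := @fp_kill_factor _ _ (gr_freeprod A) i (free_lift bb (res r)).
    suff e : group_comp (free_lift bb (res r)) (fp_inj A i) =
      @one_fun (A i) (freeprod A) by rewrite -[LHS]/(group_comp _ _ a) e.
    apply: (free_hom_ext (xb i)) => j.
    apply: etrans (free_liftE bb (res r) (Tagged J j)) _.
    by rewrite ffunE /= (negbTE ir).
  by rewrite fmorM; apply: sf_stable g _ (killu i).
have WB v w : v \in W -> w \in W -> v - w \in W :=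
  (submod_zmod_closed W).2 v w.
(* Unfolding the head [i] of [r] leaves two terms: one moves [i] into the base [T], the other misses
   the factor [i] and dies modulo [W]. *)
have dev_res r T : uniq (r ++ T) ->
    dev phi [seq res [:: i] | i <- r] (res T) - phi (res (r ++ T)) \in W.
  elim: r T => [|i r IHr] T /=; first by rewrite subrr rpred0.
  move=> /andP[irT urT].
  have iT : i \notin T by apply: contra irT; rewrite mem_cat orbC => ->.
  have -> : (res [:: i] * res T = res (i :: T))%g.
    apply/ffunP => j; rewrite !ffunE !inE; case: eqP => [->|_] /=.
      by rewrite (negbTE iT) mulg1.
    by rewrite mul1g.
  have -> : res (i :: r ++ T) = res (r ++ i :: T).
    by apply/ffunP => j; rewrite !ffunE !(inE, mem_cat) orbCA.
  rewrite addrAC; apply: WB.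
    by apply: IHr; rewrite -cat1s uniq_catCA /= irT.
  rewrite -[dev _ _ _](subrK (phi (res (r ++ T)))) rpredD ?IHr //.
  exact: resW irT.
(* With all factors as directions, [u] is congruent modulo [W] to a deviation of order [#|I|], that
   is [m], which lies in [W]. *)
have := dev_res (enum I) [::]; rewrite cats0 enum_uniq => /(_ isT).
have -> : res (enum I) = [ffun j => b j].
  by apply/ffunP => j; rewrite !ffunE mem_enum.
rewrite [phi _](act_on_basis (A := gr_freeprod A) bb) => uW.
have dW : dev phi [seq res [:: i] | i <- enum I] (res [::]) \in W.
  by apply/dev_filtrationP; apply: in_dev_dev; rewrite size_map -cardE.
by have := WB _ _ dW uW; rewrite opprB addrC subrK.
Qed.

(** Degree at most [m] is tested on [m.+1] factors, exactly the number for which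
    [dev_filtration_cross_effect] concerns K_(m+1). *)
Lemma subquot_dev_polynomial m :
  polynomial_functor (subquotf (dev_filtration m) (dev_filtration m.+1)) m.
Proof.
move=> A; set S := dev_filtration m; set T := dev_filtration m.+1.
set R := restrf S T => x; rewrite -[x]qproj_repr; set u := repr x => xkill.
suff uT : val u \in T (gr_freeprod A).
  rewrite -[RHS](linear0 (qproj (R (gr_freeprod A)))).
  by apply/qprojP; rewrite subr0.
apply: dev_filtration_cross_effect => [|i]; first exact: card_ord.
have := xkill i; rewrite [LHS]quotmapE.
rewrite -[RHS](linear0 (qproj (R _))) => /qprojP; rewrite subr0.
exact.
Qed.

Lemma subquot_dev_essential_image m :
  in_precomp_essential_image Ab
    (subquotf (dev_filtration m) (dev_filtration m.+1)).
Proof.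
apply: precomp_Ab_essential_image => X Y f g fg.
apply: linear_ext => x; rewrite -[x]qproj_repr; set u := repr x.
apply: etrans (quotmapE _ _) (etrans _ (esym (quotmapE _ _))).
apply/qprojP; exact: (dev_filtration_derived fg (valP u)).
Qed.

End Filtration.

(* The filtration is indexed from -1 to n: [Fil i.+1] is F_i, [Fil 0] is F_(-1). *)
Theorem mainTheorem4 (k : comNzRingType) (n : nat)
    (hk : ring_isomorphic k int \/ prime_field k)
    (F : functor gr (kMod k)) (hF : polynomial_functor F n) :
  exists Fil : nat -> subfunctor F,
    [/\ forall (X : gr) (x : fmod F X), x \in Fil 0 X -> x = 0%R,
        forall (X : gr) (x : fmod F X), x \in Fil n.+1 X,
        forall (i : nat), i <= n ->
          forall (X : gr) (x : fmod F X), x \in Fil i X -> x \in Fil i.+1 X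
      & forall (i : nat), i <= n ->
          polynomial_functor (subquotf (Fil i.+1) (Fil i)) (n - i)
          /\ in_precomp_essential_image Ab (subquotf (Fil i.+1) (Fil i))].
Proof.
(* The shift by one makes [Fil 0] = K_(n+1), which vanishes by the degree bound, [Fil n.+1] = K_0 =
   [F], and F_i / F_(i-1) = K_(n-i) / K_(n-i+1). *)
exists (fun i => dev_filtration F (n.+1 - i)).
split=> [X x|X x|i i_n X x|i i_n].
- by rewrite subn0; apply: dev_filtration_polynomial.
- by rewrite subnn; apply: dev_filtration0.
- by rewrite subSS subSn //; apply: dev_filtrationS.
- rewrite subSS subSn //; split; first exact: subquot_dev_polynomial.
  exact: subquot_dev_essential_image.
Qed.
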